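(* For any skew shape $\lambda'/\mu'$ in which there is at most one square in each column and at most one square in each row, the map $\mathrm{prs}_{\lambda'/\mu'}$ is injective on $\mathcal{P}(n)$, the set of all partitions of $n$ (for every positive integer $n$).
   Context: A partition $\lambda=(\lambda_1,\dots,\lambda_\ell)$ of $n$ is a nonincreasing sequence of positive integers summing to $n$; $\ell=\ell(\lambda)$ is its length. (Primes do not denote conjugation.) A skew shape $\lambda'/\mu'$ is a pair of partitions with $\ell(\lambda')\ge \ell(\mu')$ and $\lambda'_i\ge\mu'_i$ for $1\le i\le \ell(\mu')$; its squares are the squares of the Young diagram of $\lambda'$ (left-justified rows, row $i$ having $\lambda'_i$ boxes) not in that of $\mu'$. A skew semistandard Young tableau of shape $\lambda'/\mu'$ is a filling of these squares with positive integers, weakly increasing along rows and strictly increasing down columns. The skew Schur polynomial is $s_{\lambda'/\mu'}(x_1,\dots,x_\ell)=\sum_T x^T$, summed over all skew semistandard tableaux $T$ of shape $\lambda'/\mu'$ with entries in $\{1,\dots,\ell\}$, where $x^T=\prod_i x_i^{\alpha_i}$ with $\alpha_i$ the number of entries of $T$ equal to $i$; here $\ell$ must be at least the maximum column height of $\lambda'/\mu'$. For a partition $\lambda=(\lambda_1,\dots,\lambda_\ell)$ for which $s_{\lambda'/\mu'}(\lambda_1,\dots,\lambda_\ell)$ is defined and nonzero, $\mathrm{prs}_{\lambda'/\mu'}(\lambda)$ is the partition whose parts are the summands of $s_{\lambda'/\mu'}(\lambda_1,\dots,\lambda_\ell)$, one part for each tableau $T$ (so a monomial with coefficient $c>1$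 contributes $c$ equal parts).
   Formalization: The skew shape is assumed to have at least one square; for the empty shape (λ' = μ') the map sends every partition to (1), so it is not injective on P(n) for n ≥ 2. *)

(* Defs.v *)
(* Mathematical Components, with multinomials for the Schur polynomial. *)
From HB Require Import structures.
From mathcomp Require Import all_boot all_order all_algebra.
From mathcomp Require Import mpoly.

Set Implicit Arguments.
Unset Strict Implicit.
Unset Printing Implicit Defensive.

Import GRing.Theory.
Local Open Scope ring_scope.

Definition is_partition (s : seq nat) : bool :=
  sorted geq s && (0%N \notin s).

Definition partitions_of (n : nat) : pred (seq nat) :=
  [pred s | is_partition s && (sumn s == n)].

Definition is_skew_shape (la mu : seq nat) : Prop :=
  [/\ is_partition la, is_partition mu, (size mu <= size la)%N
    & forall i : nat, (i < size mu)%N -> (nth 0%N mu i <= nth 0%N la i)%N].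

(* Rows and columns are numbered from 0, and [head 0 la] is the length of the *)
(* first, hence longest, row of [la]; [nth] reads missing parts of [mu] as 0. *)
Definition skew_squares (la mu : seq nat) :
    {set 'I_(size la) * 'I_(head 0%N la)} :=
  [set c : 'I_(size la) * 'I_(head 0%N la) |
     (nth 0 mu c.1 <= c.2 < nth 0 la c.1)%N].

Definition row_length (la mu : seq nat) (i : 'I_(size la)) : nat :=
  #|[set c in skew_squares la mu | c.1 == i]|.

Definition column_height (la mu : seq nat) (j : 'I_(head 0%N la)) : nat :=
  #|[set c in skew_squares la mu | c.2 == j]|.

Section Tableaux.

Variables (la mu : seq nat) (l : nat).

Definition square := {c | c \in skew_squares la mu}.

(* The ordinal [k : 'I_l] stands for the entry k + 1. *)
Definition filling := {ffun square -> 'I_l}.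

Definition semistandard (T : filling) : bool :=
  [forall c : square, forall d : square,
     [&& (val c).1 == (val d).1 & ((val c).2 <= (val d).2)%N]
       ==> (T c <= T d)%N] &&
  [forall c : square, forall d : square,
     [&& (val c).2 == (val d).2 & ((val c).1 < (val d).1)%N]
       ==> (T c < T d)%N].

Definition content (T : filling) (i : 'I_l) : nat :=
  #|[set c : square | T c == i]|.

(* Used both with [R] a polynomial ring and with [R := nat]. *)
Definition tableau_monomial (R : comPzSemiRingType) (x : 'I_l -> R)
    (T : filling) : R :=
  \prod_(i < l) x i ^+ content T i.

Definition skew_schur : {mpoly int[l]} :=
  \sum_(T : filling | semistandard T)
     tableau_monomial (fun i : 'I_l => 'X_i : {mpoly int[l]}) T.

End Tableaux.

Definition prs_defined (la mu lam : seq nat) : Prop :=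
  (\max_(j < head 0%N la) column_height mu j <= size lam)%N /\
  (skew_schur la mu (size lam)).@[fun i => (nth 0%N lam i)%:R] != 0.

(* The values are meaningful when [prs_defined la mu lam] holds. *)
Definition prs (la mu lam : seq nat) : seq nat :=
  sort geq
    [seq tableau_monomial (fun i : 'I_(size lam) => nth 0%N lam i) T
       | T : filling la mu (size lam) in @semistandard la mu (size lam)].

Lemma prs_is_partition (la mu lam : seq nat) :
  is_partition lam -> is_partition (prs la mu lam).
Proof.
move=> /andP[_ lam0]; apply/andP; split; first exact: (sort_sorted (fun m n => leq_total n m)).
rewrite mem_sort; apply/negP => /mapP[T _] /esym/eqP.
apply/negP; rewrite -lt0n /tableau_monomial prodn_gt0 // => i.
rewrite natrXE expn_gt0; apply/orP; left; rewrite lt0n.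
by apply: contraNneq lam0 => <-; rewrite mem_nth.
Qed.

(* Main.v *)
Require Import Defs.
From mathcomp Require Import all_boot all_order all_algebra.
From mathcomp Require Import mpoly.

(** When no two squares share a row or a column, the tableau conditions are
    void: every filling is semistandard.  Distributing a product of [m] equal
    sums, where [m] is the number of squares, the skew Schur polynomial is
    therefore [(x_1 + ... + x_l)^m], and at a partition of [n] it takes the
    nonzero value [n^m].

    For injectivity, the same expansion applied to the variables [x_i^k] says
    that the [k]-th power sum of the parts of [prs lam] is the [m]-th power of
    the [k]-th power sum of the parts of [lam].  As [m > 0] and these are
    natural numbers, [prs lam] determines every power sum of [lam], the case
    [k = 0] being the length.  Finally the power sums, for all [k], determine a
    finite multiset of integers: they determine the sum over the multiset of
    the values of any polynomial, and a polynomial vanishing on all the elements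
    but one isolates the multiplicity of that one
    ([perm_eq_of_power_sums]). *)

Set Implicit Arguments.
Unset Strict Implicit.
Unset Printing Implicit Defensive.

Import GRing.Theory Num.Theory.
Local Open Scope ring_scope.

Lemma sum_horner_of_power_sums (s t : seq nat) (p : {poly int}) :
    (forall k, \sum_(x <- s) x ^ k = \sum_(x <- t) x ^ k)%N ->
  \sum_(x <- s) p.[x%:R] = \sum_(x <- t) p.[x%:R].
Proof.
move=> power_sums.
have expand (u : seq nat) :
    \sum_(x <- u) p.[x%:R] = \sum_(i < size p) p`_i * (\sum_(x <- u) x ^ i)%N%:R.
  under eq_bigr => x _ do rewrite horner_coef.
  rewrite exchange_big; apply: eq_bigr => i _ /=.
  by rewrite natr_sum mulr_sumr; apply: eq_bigr => x _; rewrite natrX.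
by rewrite !expand; apply: eq_bigr => i _; rewrite power_sums.
Qed.

(** Lagrange interpolation: the product of the [X - y], for [y] running over
    the other elements, turns equality of power sums into equality of the
    multiplicities of one element. *)
Lemma perm_eq_of_power_sums (s t : seq nat) :
    (forall k, \sum_(x <- s) x ^ k = \sum_(x <- t) x ^ k)%N ->
  perm_eq s t.
Proof.
move=> power_sums; apply/allP => v _ /=.
pose others := [seq y <- s ++ t | y != v].
pose p : {poly int} := \prod_(y <- others) ('X - (y%:R)%:P).
have p_horner (x : int) : p.[x] = \prod_(y <- others) (x - y%:R).
  by rewrite horner_prod; apply: eq_bigr => y _; rewrite hornerXsubC.
have p_v : p.[v%:R] != 0.
  rewrite p_horner prodf_seq_neq0; apply/allP => y.
  by rewrite mem_filter /= subr_eq0 eqr_nat eq_sym => /andP[].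
have p_other x : x \in s ++ t -> x != v -> p.[x%:R] = 0.
  move=> xst xv; apply/eqP; rewrite p_horner prodf_seq_eq0; apply/hasP; exists x.
    by rewrite mem_filter xv.
  by rewrite subrr /=.
have isolate (u : seq nat) :
    {subset u <= s ++ t} -> \sum_(x <- u) p.[x%:R] = p.[v%:R] *+ count_mem v u.
  move=> u_st; rewrite (bigID (pred1 v)) /= [X in _ + X]big_seq_cond.
  rewrite [X in _ + X]big1 ?addr0; last first.
    by move=> x /andP[/u_st xst xv]; exact: p_other.
  rewrite (eq_bigr (fun=> p.[v%:R])) => [|x /eqP-> //].
  by rewrite big_const_seq iter_addr_0.
have := sum_horner_of_power_sums p power_sums.
rewrite !isolate; try by move=> x xu; rewrite mem_cat xu ?orbT.
move=> /eqP; rewrite -[_ *+ count_mem v s]mulr_natr -[_ *+ count_mem v t]mulr_natr.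
by rewrite (inj_eq (mulfI p_v)) eqr_nat.
Qed.

Lemma tableau_monomialE (la mu : seq nat) (l : nat) (R : comPzSemiRingType)
    (x : 'I_l -> R) (T : filling la mu l) :
  tableau_monomial x T = \prod_c x (T c).
Proof.
rewrite (partition_big T predT) //=; apply: eq_bigr => i _.
rewrite (eq_bigr (fun=> x i)) => [|c /eqP-> //].
by rewrite prodr_const /content cardsE.
Qed.

Lemma tableau_monomialX (la mu : seq nat) (l : nat) (R : comPzSemiRingType)
    (x : 'I_l -> R) (T : filling la mu l) (k : nat) :
  tableau_monomial (fun i => x i ^+ k) T = tableau_monomial x T ^+ k.
Proof. by rewrite !tableau_monomialE prodrXl. Qed.

Section SparseShape.

Variables (la mu : seq nat).
Hypothesis rows : forall i : 'I_(size la), (row_length mu i <= 1)%N.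
Hypothesis columns : forall j : 'I_(head 0%N la), (column_height mu j <= 1)%N.

(** Each tableau condition compares two squares of one row or of one column,
    and here such squares coincide: the weak inequality is trivial, and no pair
    is subject to the strict one. *)
Lemma semistandard_sparse (l : nat) (T : filling la mu l) : semistandard T.
Proof.
have in_row (c d : square la mu) :
    (val c).1 == (val d).1 -> val c \in [set e in skew_squares la mu | e.1 == (val d).1].
  by rewrite inE => ->; rewrite (valP c).
have in_column (c d : square la mu) :
    (val c).2 == (val d).2 -> val c \in [set e in skew_squares la mu | e.2 == (val d).2].
  by rewrite inE => ->; rewrite (valP c).
apply/andP; split; apply/'forall_forallP => c d; apply/implyP => /andP[cd].
  move: (rows (val d).1) => /card_le1_eqP row_le1 _.
  by rewrite (val_inj (row_le1 _ _ (in_row c d cd) (in_row d d (eqxx _)))).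
move: (columns (val d).2) => /card_le1_eqP col_le1.
by rewrite (val_inj (col_le1 _ _ (in_column c d cd) (in_column d d (eqxx _)))) ltnn.
Qed.

(** The fillings index the terms of the expansion of the product over the
    squares of [\sum_i x i].  The ring is left general because this is used both
    for the polynomial itself and, in [nat], for the parts of [prs]. *)
Lemma sum_tableau_monomial_sparse (l : nat) (R : comPzSemiRingType)
    (x : 'I_l -> R) :
  \sum_(T : filling la mu l | semistandard T) tableau_monomial x T
    = (\sum_i x i) ^+ #|skew_squares la mu|.
Proof.
under eq_bigl => T do rewrite semistandard_sparse.
under eq_bigr => T _ do rewrite tableau_monomialE.
by rewrite -(bigA_distr_bigA (fun (_ : square la mu) i => x i)) prodr_const /square card_sig.
Qed.

(** The [k]-th power of a tableau monomial is the same monomial in the [k]-th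
    powers of the variables, so the expansion applies to every power sum. *)
Lemma power_sum_prs_sparse (lam : seq nat) (k : nat) :
  (\sum_(x <- prs la mu lam) x ^ k
     = (\sum_(x <- lam) x ^ k) ^ #|skew_squares la mu|)%N.
Proof.
rewrite (perm_big _ (permEl (perm_sort _ _))) /= big_image /=.
under eq_bigr => T _ do rewrite -natrXE -tableau_monomialX.
rewrite sum_tableau_monomial_sparse (big_nth 0%N) big_mkord natrXE.
by congr (_ ^ _)%N; apply: eq_bigr.
Qed.

Lemma meval_skew_schur_sparse (l : nat) (v : 'I_l -> int) :
  (skew_schur la mu l).@[v] = (\sum_i v i) ^+ #|skew_squares la mu|.
Proof.
rewrite /skew_schur sum_tableau_monomial_sparse rmorphXn rmorph_sum /=.
by congr (_ ^+ _); apply: eq_bigr => i _; rewrite mevalXU.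
Qed.

End SparseShape.

Theorem theorem1p8 (la mu : seq nat)
    (skew : is_skew_shape la mu)
    (nonempty : skew_squares la mu != set0)
    (rows : forall i : 'I_(size la), (row_length mu i <= 1)%N)
    (columns : forall j : 'I_(head 0%N la), (column_height mu j <= 1)%N)
    (n : nat) (n_gt0 : (0 < n)%N) :
  (forall lam : seq nat, lam \in partitions_of n -> prs_defined la mu lam) /\
  {in partitions_of n &, injective (prs la mu)}.
Proof.
split=> [lam /andP[_ /eqP sum_lam] | lam1 lam2].
  split.
    have lam_gt0 : (0 < size lam)%N.
      by case: lam sum_lam n_gt0 => //= <-.
    by apply/bigmax_leqP => j _; exact: leq_trans (columns j) lam_gt0.
  rewrite meval_skew_schur_sparse // -natr_sum expf_neq0 //.
  have -> : (\sum_(i < size lam) nth 0 lam i = n)%N.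
    by rewrite -sum_lam sumnE (big_nth 0%N) big_mkord.
  by rewrite pnatr_eq0 -lt0n.
move=> /andP[/andP[sorted1 _] _] /andP[/andP[sorted2 _] _] eq_prs.
have geq_trans : transitive geq by move=> a b c ba cb; exact: leq_trans cb ba.
have geq_anti : antisymmetric geq.
  by move=> a b; rewrite /= andbC; exact: anti_leq.
apply: (sorted_eq geq_trans geq_anti) => //.
apply: perm_eq_of_power_sums => k.
have squares_gt0 : (0 < #|skew_squares la mu|)%N by rewrite card_gt0.
by apply: (expIn squares_gt0); rewrite -!power_sum_prs_sparse // eq_prs.
Qed.
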